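(* Let $R=(r_1,\dots,r_n)$ and $S=(s_1,\dots,s_n)$ be vectors of real numbers with $\sum_i r_i=\sum_j s_j$. Then $\mathcal{T}^{\times}(R,S)\neq\emptyset$ if and only if (a) $R=S$, and (b) $R$ is palindromic, i.e. $r_i=r_{n+1-i}$ for all $i$. The same is true for $\mathcal{T}^{\times}_{\mathbb{Z}}(R,S)$: if $R$ and $S$ have nonnegative integer components, then $\mathcal{T}^{\times}_{\mathbb{Z}}(R,S)\neq\emptyset$ if and only if (a) and (b) hold.
   Context: $\mathcal{T}(R,S)$ is the set of $n\times n$ matrices with nonnegative real entries whose $i$th row sum is $r_i$ and whose $j$th column sum is $s_j$ for all $i,j$. The group $D_\times=\{\rho_0,\rho_\pi,r_{+1},r_{-1}\}$ acts on $n\times n$ matrices, where $\rho_0$ is the identity, $(\rho_\pi A)_{i,j}=a_{n+1-i,\,n+1-j}$ (rotation by $\pi$), $(r_{-1}A)_{i,j}=a_{j,i}$ (transposition), and $(r_{+1}A)_{i,j}=a_{n+1-j,\,n+1-i}$ (transposition with respect to the antidiagonal). $\mathcal{T}^{\times}(R,S)$ is the set of $A\in\mathcal{T}(R,S)$ fixed by every element of $D_\times$; $\mathcal{T}^{\times}_{\mathbb{Z}}(R,S)$ is the set of those $A\in\mathcal{T}^{\times}(R,S)$ all of whose entries are integers.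
   Formalization: The components of R and S are additionally assumed nonnegative; without this the ''if'' direction fails, e.g. for n = 1 and R = S = (-1), where (a) and (b) hold but the class is empty. *)

(* Defs.v *)
From mathcomp Require Import all_boot all_order all_algebra.
From mathcomp Require Import classical_sets reals.

Set Implicit Arguments.
Unset Strict Implicit.
Unset Printing Implicit Defensive.

Import Order.TTheory GRing.Theory Num.Theory.
Local Open Scope classical_set_scope.
Local Open Scope ring_scope.

(* Indices run over 0, .., n-1, so the reflection i |-> n+1-i of 1, .., n is
   [rev_ord]. *)

Inductive Dcross : Type := rho0 | rhopi | rplus1 | rminus1.

Definition Dcross_act (T : Type) (n : nat) (g : Dcross) (A : 'M[T]_n) :
    'M[T]_n :=
  match g with
  | rho0 => A
  | rhopi => \matrix_(i, j) A (rev_ord i) (rev_ord j)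
  | rminus1 => A^T
  | rplus1 => \matrix_(i, j) A (rev_ord j) (rev_ord i)
  end.

Definition transportation (K : realType) (n : nat) (R S : 'rV[K]_n) :
    set 'M[K]_n :=
  [set A | [/\ forall i j, 0 <= A i j,
               forall i, \sum_(j < n) A i j = R 0 i
             & forall j, \sum_(i < n) A i j = S 0 j]].

Definition transportation_cross (K : realType) (n : nat) (R S : 'rV[K]_n) :
    set 'M[K]_n :=
  [set A | transportation R S A /\ forall g, Dcross_act g A = A].

Definition transportation_cross_int (K : realType) (n : nat)
    (R S : 'rV[K]_n) : set 'M[K]_n :=
  [set A | transportation_cross R S A /\ forall i j, A i j \is a Num.int].

Definition palindromic (T : Type) (n : nat) (R : 'rV[T]_n) : Prop :=
  forall i, R 0 i = R 0 (rev_ord i).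

(* Main.v *)
Require Import Defs.
From mathcomp Require Import all_boot all_order all_algebra.
From mathcomp Require Import classical_sets reals.

Set Implicit Arguments.
Unset Strict Implicit.
Unset Printing Implicit Defensive.

Import Order.TTheory GRing.Theory Num.Theory.
Local Open Scope classical_set_scope.
Local Open Scope ring_scope.

(** Transposition swaps row and column sums and rotation by $\pi$ reverses the list of row sums, so
    a matrix fixed by both forces $R=S$ and $R$ palindromic ([transportation_cross_margins]).
    Conversely, the diagonal matrix of a nonnegative palindromic $R$ is itself a fixed point with
    margins $R$ ([transportation_cross_diag_mx]), and it is integral when $R$ is, so one witness
    serves both equivalences. *)

Lemma transportation_cross_margins (K : realType) (n : nat) (R S : 'rV[K]_n)
    (A : 'M[K]_n) :
  transportation_cross R S A -> R = S /\ palindromic R.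
Proof.
move=> [[_ rowA colA] fixA]; split.
  apply/rowP => i; rewrite -rowA -colA.
  by apply: eq_bigr => j _; rewrite -[in LHS](fixA rminus1) mxE.
(* Rotation turns row [rev_ord i] into row [i] read backwards; reversing the summation order aligns
   the two. *)
move=> i; rewrite -!rowA (reindex_inj rev_ord_inj).
by apply: eq_bigr => j _; rewrite -[in RHS](fixA rhopi) mxE rev_ordK.
Qed.

Lemma transportation_cross_diag_mx (K : realType) (n : nat) (R : 'rV[K]_n) :
  (forall i, 0 <= R 0 i) -> palindromic R ->
  transportation_cross R R (diag_mx R).
Proof.
move=> R_ge0 palR; split.
  split=> [i j|i|j]; first by rewrite mxE mulrn_wge0.
    rewrite (bigD1 i) //= mxE eqxx big1 ?addr0 // => j ne_ji.
    by rewrite mxE eq_sym (negPf ne_ji).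
  rewrite (bigD1 j) //= mxE eqxx big1 ?addr0 // => i ne_ij.
  by rewrite mxE (negPf ne_ij).
case=> //=; last exact: tr_diag_mx.
  by apply/matrixP => i j; rewrite !mxE -palR (inj_eq rev_ord_inj).
(* The antidiagonal flip also swaps the indices, leaving [R 0 j] against [R 0 i]; they need to agree
   only when [i = j]. *)
apply/matrixP => i j; rewrite !mxE -palR (inj_eq rev_ord_inj) eq_sym.
by case: eqP => // ->.
Qed.

Theorem theorem5 (K : realType) (n : nat) (R S : 'rV[K]_n)
    (R_ge0 : forall i, 0 <= R 0 i) (S_ge0 : forall j, 0 <= S 0 j)
    (sumRS : \sum_(i < n) R 0 i = \sum_(j < n) S 0 j) :
  (transportation_cross R S !=set0 <-> R = S /\ palindromic R) /\
  ((forall i, R 0 i \is a Num.nat) -> (forall j, S 0 j \is a Num.nat) ->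
   (transportation_cross_int R S !=set0 <-> R = S /\ palindromic R)).
Proof.
split=> [|natR _]; split.
- by move=> [A /transportation_cross_margins].
- move=> [<- palR]; exists (diag_mx R).
  exact: transportation_cross_diag_mx.
- by move=> [A [/transportation_cross_margins]].
- move=> [<- palR]; exists (diag_mx R); split.
    exact: transportation_cross_diag_mx.
  (* Each entry is [R 0 i] taken 0 or 1 times. *)
  by move=> i j; rewrite mxE rpredMn // intr_nat.
Qed.
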